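(* Let $A\in\mathbb{R}^{n\times n}$ be symmetric positive-definite, $b\in\mathbb{R}^n$, $x=A^{-1}b$, let $k\ge 1$ and $\Omega\in\mathbb{R}^{\ell\times n}$ (with $\Omega$ injective on $\mathcal{K}_k$, so that $\mathcal{P}^\Omega_{\mathcal{K}_k}$ is well defined), and assume $x\neq \breve{x}_k$ (equivalently $\dim\mathcal{K}_{k+1}=k+1$), so that the quantities below are well defined. Let $x_k\in\mathcal{K}_k$ be a sketched Petrov-Galerkin projection, i.e. $\langle \Omega(b-Ax_k),\Omega y\rangle=0$ for all $y\in\mathcal{K}_k$, and let $\breve{x}_k\in\mathcal{K}_k$ be the classical Petrov-Galerkin projection, i.e. $\langle b-A\breve{x}_k,y\rangle=0$ for all $y\in\mathcal{K}_k$. Then $$\|x-x_k\|_A\le\left(1+\alpha_k^2\beta_k^2\right)^{\frac12}\|x-\breve{x}_k\|_A,$$ where $$\alpha_k:=\frac{\langle x-\breve{x}_{k-1},\,\mathcal{P}_{\mathcal{K}_k}A\breve{v}_k\rangle}{\langle x-\breve{x}_{k-1},\,\mathcal{P}^\Omega_{\mathcal{K}_k}A\breve{v}_k\rangle},\qquad \beta_k:=\|A^{-\frac12}\mathcal{P}^\Omega_{\mathcal{K}_k}\breve{v}_{k+1}\|\;\langle\breve{v}_{k+1},A\breve{v}_k\rangle\;\frac{\langle\breve{v}_k,\breve{x}_k\rangle}{\|x-\breve{x}_k\|_A}.$$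
   Context: The initial guess is $x_0=0$. $\langle\cdot,\cdot\rangle$ and $\|\cdot\|$ are the Euclidean inner product and norm, and $\|z\|_A^2=\langle Az,z\rangle$. The Krylov subspaces are $\mathcal{K}_j=\mathrm{Span}\{b,Ab,\dots,A^{j-1}b\}$ for $j\geq 1$ and $\mathcal{K}_0=\{0\}$. For each $j$, $\breve{x}_j\in\mathcal{K}_j$ is the classical Petrov-Galerkin projection ($b-A\breve{x}_j\perp\mathcal{K}_j$), with $\breve{x}_0=0$. $\mathcal{P}_{\mathcal{K}_j}$ is the Euclidean orthogonal projector onto $\mathcal{K}_j$. $\mathcal{P}^\Omega_{\mathcal{K}_k}$ is the sketched orthogonal projector onto $\mathcal{K}_k$: the linear map $\mathbb{R}^n\to\mathcal{K}_k$ such that $\langle\Omega(z-\mathcal{P}^\Omega_{\mathcal{K}_k}z),\Omega y\rangle=0$ for all $z\in\mathbb{R}^n$, $y\in\mathcal{K}_k$; equivalently $\mathcal{P}^\Omega_{\mathcal{K}_k}z=\arg\min_{y\in\mathcal{K}_k}\|\Omega(z-y)\|$. For each $j\ge1$ with $\dim \mathcal{K}_j=j$, $\breve{v}_j$ is a unit vector spanning the range of $(I-\mathcal{P}_{\mathcal{K}_{j-1}})\mathcal{P}_{\mathcal{K}_j}$ (i.e. the $j$-th Arnoldi vector, up to sign). No further assumption on $\Omega$ is made. *)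

(* Defs.v *)
From mathcomp Require Import all_boot all_order all_algebra.
From mathcomp Require Import reals.

Set Implicit Arguments.
Unset Strict Implicit.
Unset Printing Implicit Defensive.

Import Order.TTheory GRing.Theory Num.Theory.
Local Open Scope ring_scope.

Definition dot (R : realType) (m : nat) (u v : 'cV[R]_m) : R :=
  \sum_(i < m) u i ord0 * v i ord0.

Definition enorm (R : realType) (m : nat) (u : 'cV[R]_m) : R :=
  Num.sqrt (dot u u).

Definition anorm (R : realType) (n : nat) (A : 'M[R]_n) (z : 'cV[R]_n) : R :=
  Num.sqrt (dot (A *m z) z).

Definition spd (R : realType) (n : nat) (A : 'M[R]_n) : Prop :=
  A^T = A /\ forall z : 'cV[R]_n, z != 0 -> 0 < dot (A *m z) z.

(* S = A^{-1/2}: the (unique) symmetric positive-definite square root of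
   A^{-1}; meant for A symmetric positive-definite. *)
Definition is_inv_sqrt (R : realType) (n : nat) (A S : 'M[R]_n) : Prop :=
  spd S /\ S *m S = invmx A.

(* Span {b, A b, ..., A^{j-1} b}; A^i b is written as an iterated product
   because 'M[R]_n carries no power operation when n may be 0. *)
Definition krylov (R : realType) (n : nat) (A : 'M[R]_n) (b : 'cV[R]_n)
    (j : nat) : {vspace 'cV[R]_n} :=
  <<mkseq (fun i => iter i (mulmx A) b) j>>%VS.

Definition is_orth_proj (R : realType) (n : nat) (K : {vspace 'cV[R]_n})
    (P : 'End('cV[R]_n)) : Prop :=
  forall z : 'cV[R]_n, P z \in K /\ forall y, y \in K -> dot (z - P z) y = 0.

Definition is_sketched_proj (R : realType) (l n : nat) (Om : 'M[R]_(l, n))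
    (K : {vspace 'cV[R]_n}) (P : 'End('cV[R]_n)) : Prop :=
  forall z : 'cV[R]_n, P z \in K /\
    forall y, y \in K -> dot (Om *m (z - P z)) (Om *m y) = 0.

Definition is_petrov_galerkin (R : realType) (n : nat) (A : 'M[R]_n)
    (b : 'cV[R]_n) (j : nat) (z : 'cV[R]_n) : Prop :=
  z \in krylov A b j /\
  forall y, y \in krylov A b j -> dot (b - A *m z) y = 0.

Definition is_sketched_petrov_galerkin (R : realType) (l n : nat)
    (Om : 'M[R]_(l, n)) (A : 'M[R]_n) (b : 'cV[R]_n) (j : nat)
    (z : 'cV[R]_n) : Prop :=
  z \in krylov A b j /\
  forall y, y \in krylov A b j -> dot (Om *m (b - A *m z)) (Om *m y) = 0.

(* Here Pprev and Pcur stand for the Euclidean orthogonal projectors onto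
   K_{j-1} and K_j, and v for the j-th Arnoldi vector, determined up to sign. *)
Definition is_arnoldi (R : realType) (n : nat) (Pprev Pcur : 'End('cV[R]_n))
    (v : 'cV[R]_n) : Prop :=
  enorm v = 1 /\ limg ((\1 - Pprev) \o Pcur)%VF = <[v]>%VS.

(* Main.v *)
Require Import Defs.
From mathcomp Require Import all_boot all_order all_algebra.
From mathcomp Require Import reals ring lra.

Set Implicit Arguments.
Unset Strict Implicit.
Unset Printing Implicit Defensive.

Import Order.TTheory GRing.Theory Num.Theory.
Local Open Scope ring_scope.

(** The whole argument lives in [K = K_k], where the sketched equations differ
    from the classical ones only by a rank-one term.  Write [v], [v'] for the
    [k]-th and [k+1]-st Arnoldi vectors, [P] and [Q] for the Euclidean and the
    sketched projectors onto [K], [q = Q v'] and [h = <v', A v>].  Since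
    [A K_{k-1}] lies in [K], only the component of [y] along [v] sends [A y]
    out of [K] ([arnoldi_decomp]), so that for [y] in [K]
      [A y = P A y + h <v, y> v']   and   [Q A y = P A y + h <v, y> q].
    The two Petrov-Galerkin conditions read [P A xb_k = b] and [Q A x_k = b],
    because [b] is in [K].  Subtracting them, the difference
    [e = x_k - xb_k] solves [P A e = - h t q] with [t = <v, x_k>].

    The factor alpha is what converts the unknown [t] into [s = <v, xb_k>].
    The vector [w = x - xb_{k-1}] is orthogonal to [A K_{k-1}], hence
    [<w, P A y>] and [<w, Q A y>] depend on [<v, y>] only.  Evaluating them at
    [xb_k] and at [x_k] gives
      [s <w, P A v> = <w, b> = t <w, Q A v>],
    so [t = alpha s].  Moreover [<w, b> = <A w, w>] is positive because
    [x] is not in [K_{k-1}], and this is why the denominator of alpha cannot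
    vanish as soon as a sketched projection [x_k] exists.

    Finally [e] is the solution of a compressed system with right-hand side
    [g = - h t q], so its energy is at most the dual energy [<g, A^-1 g>]
    ([energy_le_dual]), which is [alpha^2 beta^2 ||x - xb_k||_A^2]; and [e] is
    [A]-orthogonal to [x - xb_k], so Pythagoras ([energy_pythagoras])
    concludes.  That [v] and [v'] are available, i.e. [dim K_j = j] up to
    [j = k + 1], follows from [x <> xb_k]: otherwise the Krylov spaces would
    stagnate and contain [x] ([krylov_stagnation],
    [petrov_galerkin_exact]). *)

(** * The Euclidean inner product *)

Section Dot.
Variables (R : realType) (m : nat).
Implicit Types (u v w : 'cV[R]_m) (a : R).

Lemma dotC u v : dot u v = dot v u.
Proof. by apply: eq_bigr => i _; rewrite mulrC. Qed.

Lemma dotDl u v w : dot (u + v) w = dot u w + dot v w.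
Proof. by rewrite -big_split; apply: eq_bigr => i _; rewrite mxE mulrDl. Qed.

Lemma dotZl a u w : dot (a *: u) w = a * dot u w.
Proof. by rewrite mulr_sumr; apply: eq_bigr => i _; rewrite mxE mulrA. Qed.

Lemma dotBl u v w : dot (u - v) w = dot u w - dot v w.
Proof. by rewrite dotDl -scaleN1r dotZl mulN1r. Qed.

Lemma dotDr u v w : dot w (u + v) = dot w u + dot w v.
Proof. by rewrite dotC dotDl !(dotC w). Qed.

Lemma dotZr a u w : dot w (a *: u) = a * dot w u.
Proof. by rewrite dotC dotZl (dotC w). Qed.

Lemma dotBr u v w : dot w (u - v) = dot w u - dot w v.
Proof. by rewrite dotC dotBl !(dotC w). Qed.

Lemma dot0l u : dot 0 u = 0.
Proof. by rewrite -(scale0r 0) dotZl mul0r. Qed.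

Lemma dot_ge0 u : 0 <= dot u u.
Proof. by apply: sumr_ge0 => i _; rewrite -expr2 sqr_ge0. Qed.

Lemma dot_eq0 u : dot u u = 0 -> u = 0.
Proof.
move/eqP; rewrite psumr_eq0 => [/allP u0 | i _]; last by rewrite -expr2 sqr_ge0.
apply/colP => i; rewrite mxE; apply/eqP.
by have := u0 i (mem_index_enum i); rewrite mulf_eq0 orbb.
Qed.

Lemma enorm_sqr u : enorm u ^+ 2 = dot u u.
Proof. by rewrite sqr_sqrtr ?dot_ge0. Qed.

Lemma dot_mulmx_sym (M : 'M[R]_m) u v :
  M^T = M -> dot (M *m u) v = dot u (M *m v).
Proof.
move=> symM.
have dotE (y z : 'cV[R]_m) : dot y z = (y^T *m z) ord0 ord0.
  by rewrite mxE; apply: eq_bigr => i _; rewrite mxE.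
by rewrite !dotE trmx_mul symM mulmxA.
Qed.

End Dot.

(** * Positive-definite matrices and the energy norm *)

Section Spd.
Variables (R : realType) (n : nat) (A : 'M[R]_n).
Hypothesis spdA : spd A.
Implicit Types (e g y z : 'cV[R]_n).

Lemma spd_dotC y z : dot (A *m y) z = dot (A *m z) y.
Proof. by rewrite (dot_mulmx_sym _ _ spdA.1) dotC. Qed.

Lemma spd_ge0 z : 0 <= dot (A *m z) z.
Proof.
have [->|z0] := eqVneq z 0; first by rewrite mulmx0 dot0l.
exact/ltW/spdA.2.
Qed.

Lemma spd_mulmx_inj z : A *m z = 0 -> z = 0.
Proof.
move=> Az0; apply/eqP/negPn/negP => /spdA.2.
by rewrite Az0 dot0l ltxx.
Qed.

Lemma spd_unitmx : A \in unitmx.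
Proof.
rewrite -row_free_unit; apply: inj_row_free => u uA0.
apply: (can_inj trmxK); rewrite trmx0; apply: spd_mulmx_inj.
by rewrite -{1}spdA.1 -trmx_mul uA0 trmx0.
Qed.

Lemma anorm_sqr z : anorm A z ^+ 2 = dot (A *m z) z.
Proof. by rewrite sqr_sqrtr ?spd_ge0. Qed.

Lemma anorm_neq0 z : z != 0 -> anorm A z != 0.
Proof. by move=> z0; rewrite gt_eqF // sqrtr_gt0 spdA.2. Qed.

Lemma inv_sqrt_enorm (S : 'M[R]_n) z :
  is_inv_sqrt A S -> enorm (S *m z) ^+ 2 = dot z (invmx A *m z).
Proof.
by case=> [] [symS _] SS; rewrite enorm_sqr dot_mulmx_sym // mulmxA SS.
Qed.

(** Expanding [0 <= <A d, d>] for [d = A^-1 g - e] gives the bound directly,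
    since the two cross terms are [- 2 <g, e>].  It says that inverting the
    compression of [A] to a subspace gives at most the compression of [A^-1]. *)
Lemma energy_le_dual e g :
  dot (A *m e) e = dot g e -> dot (A *m e) e <= dot g (invmx A *m g).
Proof.
move=> Aee; have := spd_ge0 (invmx A *m g - e).
rewrite mulmxBr mulmxA mulmxV ?spd_unitmx // mul1mx.
rewrite !dotBl !dotBr (dot_mulmx_sym e (invmx A *m g) spdA.1) mulmxA.
rewrite mulmxV ?spd_unitmx // mul1mx (dotC e g) Aee; lra.
Qed.

Lemma energy_pythagoras y z :
  dot (A *m y) z = 0 ->
  dot (A *m (y - z)) (y - z) = dot (A *m y) y + dot (A *m z) z.
Proof.
by move=> yz0; rewrite mulmxBr !dotBl !dotBr (spd_dotC z y) yz0; ring.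
Qed.

End Spd.

(** * Krylov subspaces *)

Section Krylov.
Variables (R : realType) (n : nat) (A : 'M[R]_n) (b : 'cV[R]_n).
Local Notation K := (krylov A b).

Lemma krylov_subS j : (K j <= K j.+1)%VS.
Proof.
apply: sub_span => _ /mapP[i + ->]; rewrite mem_iota /= => ij.
by apply/mapP; exists i => //; rewrite mem_iota /= (leq_trans ij).
Qed.

Lemma krylov_sub i j : (i <= j)%N -> (K i <= K j)%VS.
Proof.
move=> /subnKC <-; elim: (j - i)%N => [|m IHm]; first by rewrite addn0.
by rewrite addnS; apply: subv_trans IHm (krylov_subS _).
Qed.

Lemma krylov_start j : (0 < j)%N -> b \in K j.
Proof.
by move=> j0; apply: memv_span; apply/mapP; exists 0%N; rewrite ?mem_iota.
Qed.

Lemma krylov_mulmx j y : y \in K j -> A *m y \in K j.+1.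
Proof.
move=> yK; have := memv_img (linfun (mulmx A)) yK; rewrite lfunE limg_span.
apply: subvP; apply: sub_span => _ /mapP[_ /mapP[i + ->] ->].
rewrite mem_iota lfunE /= => ij.
by apply/mapP; exists i.+1; rewrite ?mem_iota.
Qed.

Lemma krylov_dim_le j : (\dim (K j) <= j)%N.
Proof. by apply: leq_trans (dim_span _) _; rewrite size_mkseq. Qed.

(** If the dimension fails to grow at step [j + 1] then [K j] is stable under
    the injective map [A], so [A] permutes it and the solution, the preimage
    of [b], is in [K j] already. *)
Lemma krylov_stagnation j : spd A ->
  \dim (K j) = j -> \dim (K j.+1) != j.+1 -> invmx A *m b \in K j.
Proof.
move=> spdA dimj dimS.
have KS : K j = K j.+1.
  apply/eqP; rewrite eqEdim krylov_subS dimj -ltnS ltn_neqAle dimS.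
  exact: krylov_dim_le.
have kerA : lker (linfun (mulmx A) : 'End('cV[R]_n)) = 0%VS.
  apply/eqP; rewrite -subv0; apply/subvP => y.
  by rewrite memv_ker memv0 lfunE /= => /eqP/(spd_mulmx_inj spdA)->.
have AK : (linfun (mulmx A) @: K j)%VS = K j.
  apply/eqP; rewrite eqEdim limg_dim_eq ?kerA ?capv0 // leqnn andbT.
  apply/subvP => _ /memv_imgP[y yK ->]; rewrite lfunE /= KS.
  exact: krylov_mulmx.
have : b \in K j by rewrite KS krylov_start.
rewrite -{1}AK => /memv_imgP[y yK]; rewrite lfunE /= => bE.
by rewrite [X in _ *m X]bE mulmxA mulVmx ?spd_unitmx // mul1mx.
Qed.

Lemma krylov_dim k : spd A -> invmx A *m b \notin K k ->
  forall j, (j <= k.+1)%N -> \dim (K j) = j.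
Proof.
move=> spdA xK; elim=> [_|j IHj jk].
  by apply/eqP; rewrite -leqn0 krylov_dim_le.
apply/eqP/negPn/negP => dimS; apply: (negP xK).
apply: (subvP (krylov_sub (jk : (j <= k)%N))).
exact: krylov_stagnation spdA (IHj (ltnW jk)) dimS.
Qed.

(** When the solution is in [K j], so is the error; the residual is orthogonal
    to [K j], and thus the error has energy zero. *)
Lemma petrov_galerkin_exact j z : spd A ->
  is_petrov_galerkin A b j z -> invmx A *m b \in K j -> invmx A *m b = z.
Proof.
move=> spdA [zK res] xK; apply/eqP; rewrite -subr_eq0; apply/negPn/negP.
move=> /spdA.2; rewrite mulmxBr mulmxA mulmxV ?spd_unitmx // mul1mx.
by rewrite res ?ltxx // memvB.
Qed.

End Krylov.

(** * Projectors and Arnoldi vectors *)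

Section Projectors.
Variables (R : realType) (n : nat).
Implicit Types (K : {vspace 'cV[R]_n}) (P : 'End('cV[R]_n)) (y z : 'cV[R]_n).

Lemma orth_proj_dot K P y z : is_orth_proj K P -> y \in K ->
  dot (P z) y = dot z y.
Proof.
by move=> hP yK; apply/eqP; rewrite eq_sym -subr_eq0 -dotBl (hP z).2.
Qed.

(** Both projectors are characterized by their variational property: two
    candidates differ by a vector of [K] that is orthogonal to itself, in the
    sketched case after applying [Om], which is injective on [K]. *)
Lemma orth_proj_eq K P y z : is_orth_proj K P -> y \in K ->
  (forall u, u \in K -> dot (z - y) u = 0) -> P z = y.
Proof.
move=> hP yK ort; have PyK : P z - y \in K by rewrite memvB // (hP z).1.
apply/eqP; rewrite -subr_eq0; apply/eqP/dot_eq0.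
by rewrite dotBl (orth_proj_dot _ hP) // -dotBl ort.
Qed.

Lemma sketched_proj_eq l (Om : 'M[R]_(l, n)) K P y z :
  (forall u, u \in K -> Om *m u = 0 -> u = 0) ->
  is_sketched_proj Om K P -> y \in K ->
  (forall u, u \in K -> dot (Om *m (z - y)) (Om *m u) = 0) -> P z = y.
Proof.
move=> inj hP yK ort; have PyK : P z - y \in K by rewrite memvB // (hP z).1.
apply/eqP; rewrite -subr_eq0; apply/eqP/(inj _ PyK)/dot_eq0.
have {1}-> : P z - y = (z - y) - (z - P z) by rewrite opprB [RHS]addrC addrA subrK.
by rewrite mulmxBr dotBl ort // (hP z).2 // subrr.
Qed.

Section Arnoldi.
Variables (K K' : {vspace 'cV[R]_n}) (P P' : 'End('cV[R]_n)) (v : 'cV[R]_n).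
Hypotheses (hP : is_orth_proj K P) (hP' : is_orth_proj K' P').
Hypothesis hv : is_arnoldi P P' v.

Lemma arnoldi_orth y : y \in K -> dot v y = 0.
Proof.
move=> yK; have := memv_line v; rewrite -hv.2 => /memv_imgP[z _ ->].
by rewrite comp_lfunE add_lfunE opp_lfunE id_lfunE (hP _).2.
Qed.

(** [y - P y] is the image of [y] under [(1 - P) P'], hence a multiple of [v];
    pairing with the unit vector [v], orthogonal to [K], gives the factor. *)
Lemma arnoldi_decomp y : y \in K' -> y = P y + dot v y *: v.
Proof.
move=> yK'; have vv : dot v v = 1 by rewrite -enorm_sqr hv.1 expr1n.
have P'y : P' y = y by apply: (orth_proj_eq hP') => // u _; rewrite subrr dot0l.
have : ((\1 - P) \o P')%VF y \in <[v]>%VS by rewrite -hv.2 memv_img ?memvf.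
rewrite comp_lfunE add_lfunE opp_lfunE id_lfunE P'y => /vlineP[c yc].
have -> : dot v y = c.
  rewrite -[y in LHS](subrK (P y)) yc dotDr dotZr vv mulr1.
  by rewrite arnoldi_orth ?addr0 // (hP y).1.
by rewrite -yc addrC subrK.
Qed.

End Arnoldi.
End Projectors.

Theorem theorem3p1 (R : realType) (n l k : nat)
    (A : 'M[R]_n) (b x : 'cV[R]_n) (Om : 'M[R]_(l, n))
    (S : 'M[R]_n)
    (P : nat -> 'End('cV[R]_n)) (POm : 'End('cV[R]_n))
    (xb v : nat -> 'cV[R]_n) (xk : 'cV[R]_n)
    (hA : spd A)
    (hx : x = invmx A *m b)
    (hk : (1 <= k)%N)
    (hOm : forall y, y \in krylov A b k -> Om *m y = 0 -> y = 0)
    (hS : is_inv_sqrt A S)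
    (hP : forall j, is_orth_proj (krylov A b j) (P j))
    (hPOm : is_sketched_proj Om (krylov A b k) POm)
    (hxb : forall j, is_petrov_galerkin A b j (xb j))
    (hv : forall j, (1 <= j)%N -> \dim (krylov A b j) = j ->
            is_arnoldi (P j.-1) (P j) (v j))
    (hne : x <> xb k)
    (hxk : is_sketched_petrov_galerkin Om A b k xk) :
  let alpha := dot (x - xb k.-1) (P k (A *m v k))
               / dot (x - xb k.-1) (POm (A *m v k)) in
  let beta := enorm (S *m POm (v k.+1)) * dot (v k.+1) (A *m v k)
              * (dot (v k) (xb k) / anorm A (x - xb k)) in
  anorm A (x - xk)
    <= Num.sqrt (1 + alpha ^+ 2 * beta ^+ 2) * anorm A (x - xb k).
Proof.
cbv zeta.
set w := x - xb k.-1; set h := dot (v k.+1) (A *m v k).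
set s := dot (v k) (xb k); set q := POm (v k.+1).
set alpha := _ / dot w (POm _); set beta := _ * (s / _).
have AxE : A *m x = b by rewrite hx mulmxA mulmxV ?spd_unitmx // mul1mx.
have xK : invmx A *m b \notin krylov A b k.
  by apply/negP => /(petrov_galerkin_exact hA (hxb k)); rewrite -hx.
have dimK := krylov_dim hA xK.
have kE : k.-1.+1 = k by rewrite prednK.
have arn : is_arnoldi (P k.-1) (P k) (v k) by apply: hv; rewrite ?dimK.
have arn' : is_arnoldi (P k) (P k.+1) (v k.+1) by apply: (hv k.+1); rewrite ?dimK.
have bK : b \in krylov A b k by rewrite krylov_start.
have POmK y : y \in krylov A b k -> POm y = y.
  move=> yK; apply: (sketched_proj_eq hOm hPOm yK) => u _.
  by rewrite subrr mulmx0 dot0l.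
have PK y : y \in krylov A b k -> P k y = y.
  by move=> yK; apply: (orth_proj_eq (hP k) yK) => u _; rewrite subrr dot0l.
(* [A] maps [K_{k-1}] into [K_k], so only the component along [v k] matters. *)
have vperp y : y \in krylov A b k -> y - dot (v k) y *: v k \in krylov A b k.-1.
  move=> yK; rewrite {1}(arnoldi_decomp (hP _) (hP _) arn yK) addrK.
  by have [] := hP k.-1 y.
have Avperp y : y \in krylov A b k -> A *m (y - dot (v k) y *: v k) \in krylov A b k.
  by move=> /vperp/krylov_mulmx; rewrite kE.
have AE y : y \in krylov A b k ->
    A *m y = P k (A *m y) + (h * dot (v k) y) *: v k.+1.
  move=> yK.
  rewrite {1}(arnoldi_decomp (hP _) (hP _) arn' (krylov_mulmx yK)).
  congr (_ + _ *: _); apply/eqP; rewrite mulrC -dotZr -subr_eq0 -dotBr.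
  by rewrite scalemxAr -mulmxBr (arnoldi_orth (hP _) arn') ?Avperp.
have PAxb : P k (A *m xb k) = b.
  apply: (orth_proj_eq (hP k) bK) => u uK.
  by rewrite -opprB -scaleN1r dotZl (hxb k).2 ?mulr0.
have POmAxk : POm (A *m xk) = b.
  apply: (sketched_proj_eq hOm hPOm bK) => u uK.
  by rewrite -opprB mulmxN -scaleN1r dotZl hxk.2 ?mulr0.
have POmE y : y \in krylov A b k ->
    POm (A *m y) = P k (A *m y) + (h * dot (v k) y) *: q.
  move=> yK; rewrite {1}(AE y yK) linearD linearZ /= POmK //.
  by have [] := hP k (A *m y).
(* The residual of [xb k.-1], which is [A w], is orthogonal to [K_{k-1}]. *)
have worth y : y \in krylov A b k.-1 -> dot w (A *m y) = 0.
  move=> yK; rewrite dotC (spd_dotC hA) mulmxBr AxE.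
  by rewrite (hxb k.-1).2.
(* Stated for any [Q] fixing [K] pointwise, to be used for both projectors. *)
have w_last (Q : 'End('cV[R]_n)) y : (forall z, z \in krylov A b k -> Q z = z) ->
    y \in krylov A b k -> dot w (Q (A *m y)) = dot (v k) y * dot w (Q (A *m v k)).
  move=> QK yK; have := worth _ (vperp y yK); rewrite -(QK _ (Avperp y yK)).
  rewrite mulmxBr -scalemxAr linearB linearZ /= dotBr dotZr.
  by move/eqP; rewrite subr_eq0 => /eqP.
have w0 : w != 0.
  apply/eqP => /eqP; rewrite subr_eq0 => /eqP xE; case/negP: xK.
  rewrite -hx xE; apply: (subvP (krylov_sub _ _ (leq_pred k))).
  exact: (hxb k.-1).1.
have wb : dot w b != 0.
  have -> : dot w b = dot (A *m w) w.
    rewrite dotC -AxE (spd_dotC hA) {2}/w dotBr -[LHS]subr0; congr (_ - _).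
    by rewrite (spd_dotC hA) dotC worth // (hxb k.-1).1.
  by rewrite gt_eqF // hA.2.
have sN : dot w b = s * dot w (P k (A *m v k)).
  by rewrite -[in LHS]PAxb (w_last (P k) _ PK (hxb k).1).
set t := dot (v k) xk.
have tD : dot w b = t * dot w (POm (A *m v k)).
  by rewrite -[in LHS]POmAxk (w_last POm _ POmK hxk.1).
(* The denominator of [alpha] is a factor of the nonzero number [<w, b>]. *)
have tE : t = alpha * s.
  have D0 : dot w (POm (A *m v k)) != 0.
    by apply: contraNneq wb => D; rewrite tD D mulr0.
  by rewrite /alpha mulrAC mulrC -[_ * s]mulrC -sN tD mulrC mulfK.
set e := xk - xb k.
have eK : e \in krylov A b k by rewrite memvB // ?hxk.1 ?(hxb k).1.
have PAe : P k (A *m e) = - (h * t) *: q.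
  have := POmE _ hxk.1; rewrite POmAxk -/t mulmxBr linearB /= PAxb => bE.
  rewrite [X in _ - X]bE.
  by rewrite opprD addrA subrr sub0r scaleNr.
have e_le : dot (A *m e) e <= (h * t) ^+ 2 * enorm (S *m q) ^+ 2.
  rewrite (inv_sqrt_enorm _ hS).
  have -> : (h * t) ^+ 2 * dot q (invmx A *m q) =
      dot (- (h * t) *: q) (invmx A *m (- (h * t) *: q)).
    by rewrite -scalemxAr dotZl dotZr mulrA mulrNN expr2.
  by apply: energy_le_dual => //; rewrite -PAe (orth_proj_dot _ (hP k)).
have pyth : dot (A *m (x - xk)) (x - xk) =
    dot (A *m (x - xb k)) (x - xb k) + dot (A *m e) e.
  have -> : x - xk = (x - xb k) - e by rewrite /e opprB addrA subrK.
  by apply: energy_pythagoras; rewrite // mulmxBr AxE (hxb k).2.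
have a0 : anorm A (x - xb k) != 0.
  by apply: anorm_neq0 => //; rewrite subr_eq0; apply/eqP.
have le1 : 0 <= 1 + alpha ^+ 2 * beta ^+ 2.
  by rewrite addr_ge0 // mulr_ge0 ?sqr_ge0.
rewrite -ler_sqr ?nnegrE ?mulr_ge0 ?sqrtr_ge0 // exprMn (sqr_sqrtr le1).
rewrite mulrDl mul1r (anorm_sqr hA (x - xk)) pyth -(anorm_sqr hA) lerD2l.
apply: (le_trans e_le); rewrite tE /beta le_eqVlt; apply/predU1P; left.
by field.
Qed.
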